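(* Let $\widetilde{\mathcal L}$ be the twisted $N=2$ superconformal algebra over $\mathbb C$. Then every derivation of $\widetilde{\mathcal L}$ is inner, that is, $\mathrm{Der}(\widetilde{\mathcal L})=\mathrm{ad}(\widetilde{\mathcal L})$.
   Context: The twisted $N=2$ superconformal algebra $\widetilde{\mathcal L}$ is the Lie superalgebra over $\mathbb C$ with basis $\{L_n,\,T_r,\,G_p,\,\mathfrak c \mid n\in\mathbb Z,\ r\in\frac12+\mathbb Z,\ p\in\frac12\mathbb Z\}$, where the $L_n,T_r,\mathfrak c$ span the even part $\widetilde{\mathcal L}_{\bar 0}$ and the $G_p$ span the odd part $\widetilde{\mathcal L}_{\bar 1}$. The non-vanishing super brackets of basis elements are (up to super skew-symmetry; $\mathfrak c$ is central) $[L_m,L_n]=(m-n)L_{m+n}+\frac{m^3-m}{12}\delta_{m+n,0}\mathfrak c$; $[L_m,T_r]=-rT_{r+m}$; $[T_r,T_s]=\frac r3\delta_{r+s,0}\mathfrak c$; $[L_m,G_p]=(\frac m2-p)G_{p+m}$; $[T_r,G_p]=G_{p+r}$; $[G_p,G_q]=(-1)^{2p}\big(2L_{p+q}+\frac13(p^2-\frac14)\delta_{p+q,0}\mathfrak c\big)$ if $p+q\in\mathbb Z$; $[G_p,G_q]=(-1)^{2p+1}(p-q)T_{p+q}$ if $p+q\in\frac12+\mathbb Z$. For a Lie superalgebra $\mathfrak g=\mathfrak g_{\bar0}\oplus\mathfrak g_{\bar1}$ over $\mathbb C$, a homogeneous derivation of parity $[d]\in\mathbb Z_2$ is a linear map $d:\mathfrak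 g\to\mathfrak g$ with $d(\mathfrak g_{\bar i})\subset\mathfrak g_{\bar i+[d]}$ for all $\bar i\in\mathbb Z_2$ and $d([x,y])=[d(x),y]+(-1)^{[d][x]}[x,d(y)]$ for all homogeneous $x,y\in\mathfrak g$, where $[x]$ denotes the parity of $x$. $\mathrm{Der}_{\bar i}(\mathfrak g)$ is the space of homogeneous derivations of parity $\bar i$, $\mathrm{Der}(\mathfrak g)=\mathrm{Der}_{\bar0}(\mathfrak g)\oplus\mathrm{Der}_{\bar1}(\mathfrak g)$, and $\mathrm{ad}(\mathfrak g)=\{\mathrm{ad}\,x: y\mapsto[x,y]\mid x\in\mathfrak g\}$ is the inner derivation algebra. *)

(* Defs.v *)
From HB Require Import structures.
From mathcomp Require Import all_boot all_order all_algebra.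
From mathcomp Require Import finmap complex zify ring.
From mathcomp Require Import boolp classical_sets reals.
From mathcomp.multinomials Require Import monalg.

Set Implicit Arguments.
Unset Strict Implicit.
Unset Printing Implicit Defensive.

Import Order.TTheory GRing.Theory Num.Theory.
Local Open Scope ring_scope.

(* The group Z_2 of parities is [bool] with [addb], the odd parity being
   [true]; the product of two parities is [&&]. *)

Record lieSuperalgebra (K : numFieldType) := LieSuperalgebra {
  lsa_sort :> lmodType K;
  homog : bool -> lsa_sort -> Prop;
  lsbr : lsa_sort -> lsa_sort -> lsa_sort;
  homog0 : forall i, homog i 0;
  homogP : forall i a x y, homog i x -> homog i y -> homog i (a *: x + y);
  homog_split : forall x, exists x0 x1,
    [/\ homog false x0, homog true x1 & x = x0 + x1];
  homog_cap : forall x, homog false x -> homog true x -> x = 0;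
  lsbr_linl : forall z, linear (fun x => lsbr x z);
  lsbr_linr : forall x, linear (lsbr x);
  lsbr_homog : forall i j x y,
    homog i x -> homog j y -> homog (i (+) j) (lsbr x y);
  lsbr_skew : forall i j x y, homog i x -> homog j y ->
    lsbr y x = - ((-1) ^+ (i && j) *: lsbr x y);
  lsbr_jacobi : forall i j k x y z, homog i x -> homog j y -> homog k z ->
    lsbr x (lsbr y z) =
      lsbr (lsbr x y) z + (-1) ^+ (i && j) *: lsbr y (lsbr x z)
}.

Arguments homog {K l} i x.
Arguments lsbr {K l} x y.

Section Derivations.
Variables (K : numFieldType) (g : lieSuperalgebra K).
Local Open Scope classical_set_scope.

Definition homog_der (i : bool) : set (g -> g) := [set d |
  [/\ linear d,
      forall j x, homog j x -> homog (j (+) i) (d x)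
    & forall j k x y, homog j x -> homog k y ->
        d (lsbr x y) = lsbr (d x) y + (-1) ^+ (i && j) *: lsbr x (d y)]].

(* The sum of the spaces of even and of odd derivations, inside g -> g; it is
   direct since the homogeneous components of g meet in 0. *)
Definition der : set (g -> g) :=
  [set (fun x => d0 x + d1 x) | d0 in homog_der false & d1 in homog_der true].

Definition inner_der : set (g -> g) := range (fun x : g => (lsbr x : g -> g)).

End Derivations.

Arguments homog_der {K} g i.
Arguments der {K} g.
Arguments inner_der {K} g.

(* Basis: [BL n] is L_n, [BT k] is T_(k + 1/2), [BG k] is G_(k / 2), and [Bc]
   is the central element. *)
Inductive tN2_basis := BL of int | BT of int | BG of int | Bc.

Definition tN2_code (b : tN2_basis) : int + int + int + unit :=
  match b with
  | BL m => inl (inl (inl m))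
  | BT k => inl (inl (inr k))
  | BG k => inl (inr k)
  | Bc => inr tt
  end.

Definition tN2_decode (s : int + int + int + unit) : tN2_basis :=
  match s with
  | inl (inl (inl m)) => BL m
  | inl (inl (inr k)) => BT k
  | inl (inr k) => BG k
  | inr _ => Bc
  end.

Lemma tN2_codeK : cancel tN2_code tN2_decode.
Proof. by case. Qed.

HB.instance Definition _ := Choice.copy tN2_basis (can_type tN2_codeK).

Definition bparity (b : tN2_basis) : bool :=
  if b is BG _ then true else false.

Section BasisBracket.
Variable K : numFieldType.

Definition Tdeg (k : int) : K := k%:~R + 2^-1.
Definition Gdeg (k : int) : K := k%:~R / 2.

Variables (W : lmodType K) (e : tN2_basis -> W).
Local Notation L m := (e (BL m)).
Local Notation T k := (e (BT k)).
Local Notation G k := (e (BG k)).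
Local Notation c := (e Bc).

(* The bracket of two basis vectors, for a basis [e] of W.
   With p = k/2 and q = l/2, the sum p + q is an integer iff k + l is even,
   and then p + q = (k + l) %/ 2; otherwise p + q = (k + l) %/ 2 + 1/2, as
   %/ rounds down. *)
Definition bbr (a b : tN2_basis) : W :=
  match a, b with
  | BL m, BL n =>
      (m - n)%:~R *: L (m + n)
      + ((m%:~R ^+ 3 - m%:~R) / 12 * (m + n == 0)%:R) *: c
  | BL m, BT k => - Tdeg k *: T (k + m)
  | BT k, BL m => Tdeg k *: T (k + m)
  | BT k, BT l => (Tdeg k / 3 * (k + l + 1 == 0)%:R) *: c
  | BL m, BG k => (m%:~R / 2 - Gdeg k) *: G (k + 2 * m)
  | BG k, BL m => - (m%:~R / 2 - Gdeg k) *: G (k + 2 * m)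
  | BT k, BG l => G (l + (2 * k + 1))
  | BG l, BT k => - G (l + (2 * k + 1))
  | BG k, BG l =>
      if (2 %| k + l)%Z then
        (-1) ^ k *: (2 *: L ((k + l) %/ 2)%Z
                     + (3^-1 * (Gdeg k ^+ 2 - 4^-1) * (k + l == 0)%:R) *: c)
      else ((-1) ^ (k + 1) * (Gdeg k - Gdeg l)) *: T ((k + l) %/ 2)%Z
  | Bc, _ | _, Bc => 0
  end.

End BasisBracket.

Section BasisBracketFacts.
Variables (K : numFieldType) (W : lmodType K) (e : tN2_basis -> W).
Local Notation L m := (e (BL m)).
Local Notation T k := (e (BT k)).
Local Notation G k := (e (BG k)).
Local Notation c := (e Bc).
Local Notation bbr := (bbr e).
Local Notation Tdeg := (Tdeg K).
Local Notation Gdeg := (Gdeg K).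

Lemma intN1D (k l : int) : (-1) ^ (k + l) = (-1) ^ k * (-1) ^ l :> K.
Proof. by rewrite expfzDr // oppr_eq0 oner_eq0. Qed.

Lemma intN1_even (a : int) : (-1) ^ (2 * a) = 1 :> K.
Proof.
rewrite -exprz_exp (_ : (-1) ^ 2 = (-1) ^+ 2 :> K) //.
by rewrite sqrrN expr1n exp1rz.
Qed.

Lemma intN1_odd (a : int) : (-1) ^ (2 * a + 1) = -1 :> K.
Proof. by rewrite intN1D intN1_even mul1r expr1z. Qed.

Lemma Gdeg_even a : Gdeg (2 * a) = a%:~R.
Proof. by rewrite /Gdeg; field. Qed.

Lemma Gdeg_odd a : Gdeg (2 * a + 1) = a%:~R + 2^-1.
Proof. by rewrite /Gdeg; field. Qed.

Lemma bbrGG_even k l j : k + l = 2 * j -> bbr (BG k) (BG l) =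
  (-1) ^ k *: (2 *: L j
    + (3^-1 * (Gdeg k ^+ 2 - 4^-1) * (j == 0)%:R) *: c).
Proof.
move=> E /=; rewrite E ifT; last by lia.
by rewrite (_ : (2 * j == 0) = (j == 0)) ?mulKz //; lia.
Qed.

Lemma bbrGG_odd k l j : k + l = 2 * j + 1 -> bbr (BG k) (BG l) =
  ((-1) ^ (k + 1) * (Gdeg k - Gdeg l)) *: T j.
Proof.
move=> E /=; rewrite E ifF; last by lia.
by rewrite (_ : ((2 * j + 1) %/ 2)%Z = j) //; lia.
Qed.

(* Opaque names for the two kinds of indices of the G's. *)
Definition ev_def (a : int) : int := 2 * a.
Definition od_def (a : int) : int := 2 * a + 1.
Fact G_key : unit. Proof. exact: tt. Qed.
Definition ev := locked_with G_key ev_def.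
Definition od := locked_with G_key od_def.
Lemma evE a : ev a = 2 * a. Proof. by rewrite /ev unlock. Qed.
Lemma odE a : od a = 2 * a + 1. Proof. by rewrite /od unlock. Qed.

Lemma ev_od (k : int) : exists a, k = ev a \/ k = od a.
Proof. by exists (k %/ 2)%Z; rewrite evE odE; lia. Qed.

Lemma bbrGG_ee a b : bbr (BG (ev a)) (BG (ev b)) =
  2 *: L (a + b) + (3^-1 * (a%:~R ^+ 2 - 4^-1) * (a + b == 0)%:R) *: c.
Proof.
rewrite ?(evE, odE).
by rewrite (@bbrGG_even _ _ (a + b)) ?Gdeg_even ?intN1_even ?scale1r //; lia.
Qed.

Lemma bbrGG_oo a b : bbr (BG (od a)) (BG (od b)) =
  - (2 *: L (a + b + 1) + (3^-1 * ((a%:~R + 2^-1) ^+ 2 - 4^-1)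
                            * (a + b + 1 == 0)%:R) *: c).
Proof.
rewrite ?(evE, odE).
rewrite (@bbrGG_even _ _ (a + b + 1)) ?Gdeg_odd ?intN1_odd ?scaleN1r //; lia.
Qed.

Lemma bbrGG_eo a b : bbr (BG (ev a)) (BG (od b)) =
  - (a%:~R - (b%:~R + 2^-1)) *: T (a + b).
Proof.
rewrite ?(evE, odE).
rewrite (@bbrGG_odd _ _ (a + b)) ?Gdeg_even ?Gdeg_odd ?intN1_odd ?mulN1r //; lia.
Qed.

Lemma bbrGG_oe a b : bbr (BG (od a)) (BG (ev b)) =
  (a%:~R + 2^-1 - b%:~R) *: T (a + b).
Proof.
rewrite ?(evE, odE) (@bbrGG_odd _ _ (a + b)); last by lia.
by rewrite Gdeg_even Gdeg_odd intN1D intN1_odd expr1z mulN1r opprK mul1r.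
Qed.

Lemma bbrLG_e m a : bbr (BL m) (BG (ev a)) =
  (m%:~R / 2 - a%:~R) *: G (ev (a + m)).
Proof. by rewrite ?(evE, odE) -(Gdeg_even a) mulrDr. Qed.

Lemma bbrLG_o m a : bbr (BL m) (BG (od a)) =
  (m%:~R / 2 - (a%:~R + 2^-1)) *: G (od (a + m)).
Proof. by rewrite ?(evE, odE) -(Gdeg_odd a) mulrDr addrAC. Qed.

Lemma bbrGL_e m a : bbr (BG (ev a)) (BL m) =
  - (m%:~R / 2 - a%:~R) *: G (ev (a + m)).
Proof. by rewrite ?(evE, odE) -(Gdeg_even a) mulrDr. Qed.

Lemma bbrGL_o m a : bbr (BG (od a)) (BL m) =
  - (m%:~R / 2 - (a%:~R + 2^-1)) *: G (od (a + m)).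
Proof. by rewrite ?(evE, odE) -(Gdeg_odd a) mulrDr addrAC. Qed.

Lemma bbrTG_e k a : bbr (BT k) (BG (ev a)) = G (od (a + k)).
Proof. by rewrite ?(evE, odE) mulrDr -addrA. Qed.

Lemma bbrTG_o k a : bbr (BT k) (BG (od a)) = G (ev (a + k + 1)).
Proof.
by rewrite ?(evE, odE) /= (_ : _ + (_ + _) = 2 * (a + k + 1)) //; ring.
Qed.

Lemma bbrGT_e k a : bbr (BG (ev a)) (BT k) = - G (od (a + k)).
Proof. by rewrite ?(evE, odE) mulrDr -addrA. Qed.

Lemma bbrGT_o k a : bbr (BG (od a)) (BT k) = - G (ev (a + k + 1)).
Proof.
by rewrite ?(evE, odE) /= (_ : _ + (_ + _) = 2 * (a + k + 1)) //; ring.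
Qed.

Lemma bbrLL m n : bbr (BL m) (BL n) =
  (m - n)%:~R *: L (m + n)
  + ((m%:~R ^+ 3 - m%:~R) / 12 * (m + n == 0)%:R) *: c.
Proof. by []. Qed.

Lemma bbrLT m k : bbr (BL m) (BT k) = - (k%:~R + 2^-1) *: T (k + m).
Proof. by []. Qed.

Lemma bbrTL m k : bbr (BT k) (BL m) = (k%:~R + 2^-1) *: T (k + m).
Proof. by []. Qed.

Lemma bbrTT k l : bbr (BT k) (BT l) =
  ((k%:~R + 2^-1) / 3 * (k + l + 1 == 0)%:R) *: c.
Proof. by []. Qed.

Lemma bbrcl b : bbr Bc b = 0. Proof. by []. Qed.

Lemma bbrcr b : bbr b Bc = 0. Proof. by case: b. Qed.

Definition bbrS := (bbrGG_ee, bbrGG_eo, bbrGG_oe, bbrGG_oo, bbrLG_e, bbrLG_o,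
  bbrGL_e, bbrGL_o, bbrTG_e, bbrTG_o, bbrGT_e, bbrGT_o, bbrLL, bbrLT, bbrTL,
  bbrTT, bbrcl, bbrcr).

End BasisBracketFacts.

Section BasisIdentities.
Variables (K : numFieldType) (W : lmodType K) (e : tN2_basis -> W).
Variable f : W -> K.
Hypothesis f0 : f 0 = 0.
Hypothesis fD : {morph f : x y / x + y}.
Hypothesis fN : {morph f : x / - x}.
Hypothesis fZ : forall a x, f (a *: x) = a * f x.
Let fS := (fD, fN, fZ, f0, mulr0).
Local Notation bbr := (bbr e).

Ltac split_parity p :=
  try match goal with |- context [BG p] =>
    let a := fresh "a" in
    have [a [->|->]] := ev_od p; clear p; rename a into p end.

Ltac same_index :=
  repeat match goal with
  | |- context [e (BL ?i)] => match goal with |- context [e (BL ?j)] =>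
      tryif constr_eq i j then fail else
        (rewrite (_ : j = i :> int); last by ring) end
  | |- context [e (BT ?i)] => match goal with |- context [e (BT ?j)] =>
      tryif constr_eq i j then fail else
        (rewrite (_ : j = i :> int); last by ring) end
  | |- context [ev ?i] => match goal with |- context [ev ?j] =>
      tryif constr_eq i j then fail else
        (rewrite (_ : j = i :> int); last by ring) end
  | |- context [od ?i] => match goal with |- context [od ?j] =>
      tryif constr_eq i j then fail else
        (rewrite (_ : j = i :> int); last by ring) end
  | |- context [@eq_op _ ?i _] => match goal with
      |- context [@eq_op _ ?j _] => tryif constr_eq i j then fail else
        (rewrite (_ : j = i :> int); last by ring) end
  end.

(* Where the central term does not vanish, the index z is eliminated. *)
Ltac central z :=
  repeat match goal with |- context [@eq_op _ ?i _] =>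
    case: (@eqP _ i 0); [
      let E := fresh "E" in let F := eval pattern z in i in
      match F with ?H _ => move=> E;
        let E' := fresh "E" in
        have E' : z = - (H 0) by (cbv beta; lia) end; subst z
    | move=> _ ]
  end.

Ltac solve_in_f z :=
  rewrite ?fS; same_index;
  first [by ring | by central z; rewrite ?mulr1n ?mulr0n; field].

Lemma f_skew a b :
  f (bbr b a) = f (- ((-1) ^+ (bparity a && bparity b) *: bbr a b)).
Proof.
case: a b => [x|x|x|] [z|z|z|]; rewrite /bparity /andb.
all: split_parity x; split_parity z; rewrite ?bbrS; solve_in_f z.
Qed.

Variable br : W -> W -> W.
Hypothesis brDl : forall x y z, br (x + y) z = br x z + br y z.
Hypothesis brDr : forall x y z, br z (x + y) = br z x + br z y.
Hypothesis brZl : forall a x z, br (a *: x) z = a *: br x z.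
Hypothesis brZr : forall a x z, br z (a *: x) = a *: br z x.
Hypothesis brNl : forall x z, br (- x) z = - br x z.
Hypothesis brNr : forall x z, br z (- x) = - br z x.
Hypothesis br0l : forall z, br 0 z = 0.
Hypothesis br0r : forall z, br z 0 = 0.
Hypothesis brE : forall a b, br (e a) (e b) = bbr a b.
Let brS := (brDl, brDr, brZl, brZr, brNl, brNr, br0l, br0r, brE).

Lemma f_jacobi a b c : f (br (e a) (br (e b) (e c))) =
  f (br (br (e a) (e b)) (e c)
     + (-1) ^+ (bparity a && bparity b) *: br (e b) (br (e a) (e c))).
Proof.
case: a b c => [x|x|x|] [y|y|y|] [z|z|z|]; rewrite /bparity /andb.
all: split_parity x; split_parity y; split_parity z.
all: rewrite ?(brS, bbrS); solve_in_f z.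
Qed.

End BasisIdentities.

Section TwistedN2.
Variable K : numFieldType.
Local Notation V := {malg K[tN2_basis]}.
Local Notation vbr := (bbr (fun d => << d >> : V)).

Definition tN2_br (x y : V) : V :=
  \sum_(a <- msupp x) \sum_(b <- msupp y) (x@_a * y@_b) *: vbr a b.

Definition tN2_homog (i : bool) (x : V) : Prop :=
  forall b, b \in msupp x -> bparity b = i.

Lemma tN2_brw (d1 d2 : {fset tN2_basis}) x y :
  (msupp x `<=` d1)%fset -> (msupp y `<=` d2)%fset ->
  tN2_br x y = \sum_(a <- d1) \sum_(b <- d2) (x@_a * y@_b) *: vbr a b.
Proof.
move=> le_d1 le_d2; rewrite /tN2_br (big_fset_incl _ le_d1) /=.
  apply/eq_bigr => a _; apply/big_fset_incl => // b _ /mcoeff_outdom ->.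
  by rewrite mulr0 scale0r.
move=> a _ /mcoeff_outdom xa.
by rewrite big1 // => b _; rewrite xa mul0r scale0r.
Qed.

Lemma tN2_br_linl z : linear (fun x => tN2_br x z).
Proof.
move=> a x y.
pose d := (msupp x `|` msupp y `|` msupp (a *: x + y))%fset.
have sx : (msupp x `<=` d)%fset by rewrite /d -fsetUA fsubsetUl.
have sy : (msupp y `<=` d)%fset.
  by rewrite /d [(msupp x `|` _)%fset]fsetUC -fsetUA fsubsetUl.
have sz : (msupp (a *: x + y) `<=` d)%fset by rewrite /d fsubsetUr.
rewrite (tN2_brw sx (fsubset_refl _)) (tN2_brw sy (fsubset_refl _)).
rewrite (tN2_brw sz (fsubset_refl _)) scaler_sumr -big_split /=.
apply: eq_bigr => b _; rewrite scaler_sumr -big_split /=.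
apply: eq_bigr => b' _.
by rewrite mcoeffD mcoeffZ mulrDl scalerDl scalerA mulrA.
Qed.

Lemma tN2_br_linr z : linear (tN2_br z).
Proof.
move=> a x y.
pose d := (msupp x `|` msupp y `|` msupp (a *: x + y))%fset.
have sx : (msupp x `<=` d)%fset by rewrite /d -fsetUA fsubsetUl.
have sy : (msupp y `<=` d)%fset.
  by rewrite /d [(msupp x `|` _)%fset]fsetUC -fsetUA fsubsetUl.
have sz : (msupp (a *: x + y) `<=` d)%fset by rewrite /d fsubsetUr.
rewrite (tN2_brw (fsubset_refl _) sx) (tN2_brw (fsubset_refl _) sy).
rewrite (tN2_brw (fsubset_refl _) sz) scaler_sumr -big_split /=.
apply: eq_bigr => b _; rewrite scaler_sumr -big_split /=.
apply: eq_bigr => b' _.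
by rewrite mcoeffD mcoeffZ mulrDr scalerDl scalerA mulrCA.
Qed.

Lemma tN2_brDl x y z : tN2_br (x + y) z = tN2_br x z + tN2_br y z.
Proof. by have := tN2_br_linl z 1 x y; rewrite !scale1r. Qed.

Lemma tN2_brDr x y z : tN2_br z (x + y) = tN2_br z x + tN2_br z y.
Proof. by have := tN2_br_linr z 1 x y; rewrite !scale1r. Qed.

Lemma tN2_br0l z : tN2_br 0 z = 0.
Proof. by apply: (addrI (tN2_br 0 z)); rewrite -tN2_brDl !addr0. Qed.

Lemma tN2_br0r z : tN2_br z 0 = 0.
Proof. by apply: (addrI (tN2_br z 0)); rewrite -tN2_brDr !addr0. Qed.

Lemma tN2_brZl a x z : tN2_br (a *: x) z = a *: tN2_br x z.
Proof. by have := tN2_br_linl z a x 0; rewrite !addr0 tN2_br0l addr0. Qed.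

Lemma tN2_brZr a x z : tN2_br z (a *: x) = a *: tN2_br z x.
Proof. by have := tN2_br_linr z a x 0; rewrite !addr0 tN2_br0r addr0. Qed.

Lemma tN2_brNl x z : tN2_br (- x) z = - tN2_br x z.
Proof. by rewrite -scaleN1r tN2_brZl scaleN1r. Qed.

Lemma tN2_brNr x z : tN2_br z (- x) = - tN2_br z x.
Proof. by rewrite -scaleN1r tN2_brZr scaleN1r. Qed.

Lemma tN2_brE a b : tN2_br << a >> << b >> = vbr a b.
Proof.
rewrite (tN2_brw msuppU_le msuppU_le) !big_seq_fset1.
by rewrite !mcoeffUU mulr1 scale1r.
Qed.

Lemma tN2_homog0 i : tN2_homog i 0.
Proof. by move=> b; rewrite msupp0 inE. Qed.

Lemma tN2_homogP i a x y :
  tN2_homog i x -> tN2_homog i y -> tN2_homog i (a *: x + y).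
Proof.
move=> hx hy b /(fsubsetP (msuppD_le _ _)); rewrite inE => /orP[|/hy//].
by move/(fsubsetP (msuppZ_le _ _))/hx.
Qed.

Lemma tN2_homogD i x y : tN2_homog i x -> tN2_homog i y -> tN2_homog i (x + y).
Proof. by move=> hx hy; rewrite -[x]scale1r; apply: tN2_homogP. Qed.

Lemma tN2_homogZ i a x : tN2_homog i x -> tN2_homog i (a *: x).
Proof.
by move=> hx; rewrite -[_ *: _]addr0; apply: tN2_homogP => //; apply: tN2_homog0.
Qed.

Lemma tN2_homogN i x : tN2_homog i x -> tN2_homog i (- x).
Proof. by move=> hx; rewrite -scaleN1r; apply: tN2_homogZ. Qed.

Lemma tN2_homogU b : tN2_homog (bparity b) << b >>.
Proof. by move=> b' /(fsubsetP msuppU_le); rewrite inE => /eqP->. Qed.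

Lemma tN2_homog_ind (i : bool) (P : V -> Prop) :
  P 0 -> (forall a x y, P x -> P y -> P (a *: x + y)) ->
  (forall b, bparity b = i -> P << b >>) -> forall x, tN2_homog i x -> P x.
Proof.
move=> P0 PP Pb x hx; rewrite [x]monalgE big_seq.
elim/big_rec: _ => // b y bx Py.
suff -> : << x@_b *g b >> = x@_b *: << b >> :> V.
  by apply: PP => //; apply/Pb/hx.
by apply/malgP => d; rewrite mcoeffZ !mcoeffU mulrnAr mulr1.
Qed.

Lemma tN2_homog_split x : exists x0 x1,
  [/\ tN2_homog false x0, tN2_homog true x1 & x = x0 + x1].
Proof.
rewrite [x]monalgE; elim/big_rec: _ => [|b y _ [y0 [y1 [h0 h1 ->]]]].
  by exists 0, 0; split; rewrite ?addr0 //; apply: tN2_homog0.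
have hb : tN2_homog (bparity b) << x@_b *g b >>.
  by move=> b' /(fsubsetP msuppU_le); rewrite inE => /eqP->.
case Eb : (bparity b) hb => hb.
  exists y0, (<< x@_b *g b >> + y1); split=> //; last by rewrite addrCA.
  exact: tN2_homogD.
exists (<< x@_b *g b >> + y0), y1; split=> //; last by rewrite addrA.
exact: tN2_homogD.
Qed.

Lemma tN2_homog_cap x : tN2_homog false x -> tN2_homog true x -> x = 0.
Proof.
move=> h0 h1; rewrite [x]monalgE big_seq big1 // => b bx.
by have := h1 b bx; rewrite (h0 b bx).
Qed.

Lemma tN2_bbr_homog a b : tN2_homog (bparity a (+) bparity b) (vbr a b).
Proof.
have U i d : bparity d = i -> tN2_homog i << d >> by move=> <-; apply: tN2_homogU.
case: a b => [m|k|k|] [n|l|l|] /=; try exact: tN2_homog0.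
- by apply: tN2_homogD; apply/tN2_homogZ/U.
- by apply/tN2_homogZ/U.
- by apply/tN2_homogZ/U.
- by apply/tN2_homogZ/U.
- by apply/tN2_homogZ/U.
- by apply/U.
- by apply/tN2_homogZ/U.
- by apply/tN2_homogN/U.
case: ifP => _; last by apply/tN2_homogZ/U.
by apply/tN2_homogZ/tN2_homogD; apply/tN2_homogZ/U.
Qed.

Lemma tN2_br_homog i j x y :
  tN2_homog i x -> tN2_homog j y -> tN2_homog (i (+) j) (tN2_br x y).
Proof.
move=> hx hy; move: x hx; apply: tN2_homog_ind.
- by rewrite tN2_br0l; apply: tN2_homog0.
- by move=> a x x' hx hx'; rewrite tN2_br_linl; apply: tN2_homogP.
move=> b <-; move: y hy; apply: tN2_homog_ind.
- by rewrite tN2_br0r; apply: tN2_homog0.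
- by move=> a x x' hx hx'; rewrite tN2_br_linr; apply: tN2_homogP.
by move=> b' <-; rewrite tN2_brE; apply: tN2_bbr_homog.
Qed.

Lemma tN2_br_skew i j x y : tN2_homog i x -> tN2_homog j y ->
  tN2_br y x = - ((-1) ^+ (i && j) *: tN2_br x y).
Proof.
move=> hx hy; move: x hx; apply: tN2_homog_ind.
- by rewrite tN2_br0l tN2_br0r scaler0 oppr0.
- move=> a x x' Hx Hx'; rewrite tN2_br_linr tN2_br_linl Hx Hx'.
  by rewrite scalerDr !scalerA mulrC -scalerA scalerN opprD.
move=> b <-; move: y hy; apply: tN2_homog_ind.
- by rewrite tN2_br0l tN2_br0r scaler0 oppr0.
- move=> a x x' Hx Hx'; rewrite tN2_br_linr tN2_br_linl Hx Hx'.
  by rewrite scalerDr !scalerA mulrC -scalerA scalerN opprD.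
move=> b' <-; rewrite !tN2_brE; apply/malgP => d.
apply: (@f_skew _ _ (fun b => << b >> : V) (mcoeff d)) => *.
- exact: mcoeff0.
- exact: mcoeffD.
- exact: mcoeffN.
- exact: mcoeffZ.
Qed.

Lemma tN2_br_jacobi i j k x y z :
  tN2_homog i x -> tN2_homog j y -> tN2_homog k z ->
  tN2_br x (tN2_br y z) =
    tN2_br (tN2_br x y) z + (-1) ^+ (i && j) *: tN2_br y (tN2_br x z).
Proof.
have comb (s a : K) (u v u' v' : V) :
    a *: (u + s *: v) + (u' + s *: v') = a *: u + u' + s *: (a *: v + v').
  by rewrite !scalerDr !scalerA [s * a]mulrC addrACA.
move=> hx hy hz; move: x hx; apply: tN2_homog_ind.
- by rewrite !(tN2_br0l, tN2_br0r) scaler0 addr0.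
- move=> a x x' Hx Hx'; rewrite !(tN2_br_linl, tN2_br_linr) Hx Hx'.
  exact: comb.
move=> b <-; move: y hy; apply: tN2_homog_ind.
- by rewrite !(tN2_br0l, tN2_br0r) scaler0 addr0.
- move=> a x x' Hx Hx'; rewrite !(tN2_br_linl, tN2_br_linr) Hx Hx'.
  exact: comb.
move=> b' <-; move: z hz; apply: tN2_homog_ind.
- by rewrite !(tN2_br0l, tN2_br0r) scaler0 addr0.
- move=> a x x' Hx Hx'; rewrite !(tN2_br_linl, tN2_br_linr) Hx Hx'.
  exact: comb.
move=> b'' _; apply/malgP => d.
apply: (@f_jacobi _ _ (fun b => << b >> : V) (mcoeff d)) => *.
- exact: mcoeff0.
- exact: mcoeffD.
- exact: mcoeffN.
- exact: mcoeffZ.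
- exact: tN2_brDl.
- exact: tN2_brDr.
- exact: tN2_brZl.
- exact: tN2_brZr.
- exact: tN2_brNl.
- exact: tN2_brNr.
- exact: tN2_br0l.
- exact: tN2_br0r.
- exact: tN2_brE.
Qed.

Definition twisted_N2 : lieSuperalgebra K :=
  LieSuperalgebra tN2_homog0 tN2_homogP tN2_homog_split tN2_homog_cap
    tN2_br_linl tN2_br_linr tN2_br_homog tN2_br_skew tN2_br_jacobi.

End TwistedN2.

(* Main.v *)
Require Import Defs.
From mathcomp Require Import all_boot all_order all_algebra.
From mathcomp Require Import complex boolp classical_sets reals.
From mathcomp Require Import finmap zify ring.
From mathcomp.multinomials Require Import monalg.

Import Order.TTheory GRing.Theory Num.Theory.

Set Implicit Arguments.
Unset Strict Implicit.
Unset Printing Implicit Defensive.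

Local Open Scope ring_scope.

(** It is enough to treat a homogeneous derivation d ([der_eq_inner]).

    The operator ad L_0 is diagonal in the given basis, with eigenvalue minus
    the index, so the components of d(L_0) of nonzero degree lie in its image:
    subtracting an inner derivation makes d(L_0) of degree 0
    ([der_weight0_sub]).  Applying d to [L_0, x] = - deg(x) x then shows that d
    preserves the degree ([der_weight]).

    The algebra is generated by the T_r and G_0, so only the values of d there
    matter ([der_inner_of_gen]), and few are possible once the degree is kept.
    - If d is even, d(T_r) = t_r T_r and d(G_0) = s G_0.  The relation
      [G_0, [T_r, G_0]] = r T_r gives s = 0, and since [T_r, [T_r', G_0]] =
      G_(r+r') depends only on r + r', the t_r form an arithmetic progression;
      it is linear in r because t_r + t_(-r) = 0.  So d is a multiple of
      ad L_0 ([even_der_inner]).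
    - If d is odd, d(T_r) = t_r G_r, and [T_r, T_r'] = 0 for r + r' != 0 makes
      t_r constant, so that a multiple of ad G_0 can be subtracted to get
      d(T_r) = 0.  What is left of d(G_0) is a combination a L_0 + b c; since
      G_0 = [T_(-1/2), [T_(1/2), G_0]], it is also a multiple of c
      proportional to a.  Hence a = 0, and with it d(G_0) = 0
      ([odd_der_inner]). *)

(** * Derivations of a Lie superalgebra *)

Section LieSuperalgebraDerivations.
Variables (K : numFieldType) (g : lieSuperalgebra K).
Implicit Types (i : bool) (d : g -> g) (x y z : g).

Lemma lsbrDl x y z : lsbr (x + y) z = lsbr x z + lsbr y z.
Proof. by have := lsbr_linl z 1 x y; rewrite !scale1r. Qed.

Lemma lsbr_homog_der i y : homog i y -> homog_der g i (lsbr y).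
Proof.
move=> hy; split=> [|j x hx|j k x z hx hz]; first exact: lsbr_linr.
- by rewrite addbC; apply: lsbr_homog.
- exact: lsbr_jacobi hy hx hz.
Qed.

Lemma homog_derB i d d' : homog_der g i d -> homog_der g i d' ->
  homog_der g i (fun x => d x - d' x).
Proof.
move=> [dl dh dL] [dl' dh' dL'].
split=> [a x y|j x hx|j k x y hx hy].
- by rewrite dl dl' scalerBr opprD addrACA.
- rewrite addrC -scaleN1r; apply: homogP; [exact: dh'|exact: dh].
- have BrB u v w : lsbr (u - v) w = lsbr u w - lsbr v w.
    by rewrite addrC -scaleN1r lsbr_linl scaleN1r addrC.
  have BrBr u v w : lsbr w (u - v) = lsbr w u - lsbr w v.
    by rewrite addrC -scaleN1r lsbr_linr scaleN1r addrC.
  rewrite (dL _ _ _ _ hx hy) (dL' _ _ _ _ hx hy) BrB BrBr.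
  by rewrite scalerBr opprD addrACA.
Qed.

Lemma inner_der_sub : (inner_der g `<=` der g)%classic.
Proof.
move=> _ [x _ <-]; have [x0 [x1 [h0 h1 ->]]] := homog_split x.
exists (lsbr x0); first exact: lsbr_homog_der.
exists (lsbr x1); first exact: lsbr_homog_der.
by apply/funext => z; rewrite lsbrDl.
Qed.

Lemma der_eq_inner :
  (forall i d, homog_der g i d -> inner_der g d) -> der g = inner_der g.
Proof.
move=> inn; apply/seteqP; split; last exact: inner_der_sub.
move=> _ [d0 /inn[x0 _ <-] [d1 /inn[x1 _ <-] <-]].
by exists (x0 + x1) => //; apply/funext => z; rewrite lsbrDl.
Qed.

End LieSuperalgebraDerivations.

(** * The grading by eigenvalues of [ad L_0] *)

Section TwistedN2Derivations.
Variable K : numFieldType.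
Local Notation V := {malg K[tN2_basis]}.
Local Notation br := (@tN2_br K).
Local Notation hder := (homog_der (twisted_N2 K)).
Local Notation L m := (<< BL m >> : V).
Local Notation T k := (<< BT k >> : V).
Local Notation G k := (<< BG k >> : V).
Local Notation c := (<< Bc >> : V).

Definition tN2_deg (b : tN2_basis) : K :=
  match b with
  | BL m => m%:~R
  | BT k => Tdeg K k
  | BG k => Gdeg K k
  | Bc => 0
  end.

Lemma tN2_brL0 b : br (L 0) << b >> = - tN2_deg b *: << b >>.
Proof.
rewrite tN2_brE; case: b => [m|k|k|] /=.
- by rewrite sub0r add0r !mulr0z expr0n subr0 !mul0r scale0r addr0 rmorphN.
- by rewrite addr0.
- by rewrite mulr0z mul0r sub0r mulr0 addr0.
- by rewrite oppr0 scale0r.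
Qed.

Lemma malg_ind (P : V -> Prop) : P 0 ->
  (forall a x y, P x -> P y -> P (a *: x + y)) ->
  (forall b, P << b >>) -> forall x, P x.
Proof.
move=> P0 PP Pb x; have [x0 [x1 [h0 h1 ->]]] := tN2_homog_split x.
rewrite -[x0]scale1r; apply: (PP); first exact: (tN2_homog_ind P0 PP _ h0).
exact: (tN2_homog_ind P0 PP _ h1).
Qed.

Lemma mcoeff_brL0 (x : V) b : (br (L 0) x)@_b = - tN2_deg b * x@_b.
Proof.
move: x; apply: malg_ind => [|a x y hx hy|b'].
- by rewrite tN2_br0r mcoeff0 mulr0.
- by rewrite tN2_br_linr !mcoeffD !mcoeffZ hx hy; ring.
- rewrite tN2_brL0 mcoeffZ mcoeffU; case: eqVneq => [->|_] //.
  by rewrite !mulr0n !mulr0.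
Qed.

(** The vectors of degree p, defined as eigenvectors of ad L_0 so that the
    Jacobi identity makes the bracket additive on degrees. *)
Definition weight (p : K) (x : V) := br (L 0) x = - p *: x.

Lemma weightP p (x : V) :
  weight p x <-> (forall b, tN2_deg b != p -> x@_b = 0).
Proof.
split=> [wx b neq|wx].
  have /eqP := congr1 (mcoeff b) wx.
  rewrite mcoeff_brL0 mcoeffZ -subr_eq0 -mulrBl.
  by rewrite mulf_eq0 opprK addrC subr_eq0 eq_sym (negPf neq) => /eqP.
apply/malgP => b; rewrite mcoeff_brL0 mcoeffZ.
by have [->//|/wx->] := eqVneq (tN2_deg b) p; rewrite !mulr0.
Qed.

Lemma weight_basis b : weight (tN2_deg b) << b >>.
Proof. exact: tN2_brL0. Qed.

Lemma weight_br i j p q x y : tN2_homog i x -> tN2_homog j y ->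
  weight p x -> weight q y -> weight (p + q) (br x y).
Proof.
move=> hx hy wx wy; have hL : tN2_homog false (L 0) := @tN2_homogU K (BL 0).
rewrite /weight (tN2_br_jacobi hL hx hy) wx wy tN2_brZl tN2_brZr.
by rewrite scale1r -scalerDl opprD.
Qed.

(** Since [y, L_0] multiplies the coefficient of y at a basis vector by its
    degree, this y cancels the part of nonzero degree of u when u = d(L_0).
    In degree 0 the quotient is 0, as division by 0 gives 0. *)
Lemma exists_L0_integral i (u : V) : tN2_homog i u ->
  exists2 y, tN2_homog i y & forall b, y@_b = u@_b / tN2_deg b.
Proof.
move=> hu; exists (\sum_(b <- msupp u) (u@_b / tN2_deg b) *: << b >>).
  rewrite big_seq; elim/big_rec: _ => [|b y bu hy]; first exact: tN2_homog0.
  by apply: tN2_homogP => //; rewrite -(hu b bu); apply: tN2_homogU.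
move=> b; rewrite raddf_sum /=.
under eq_bigr => b' _ do rewrite mcoeffZ mcoeffU -mulr_natr mul1r.
have [bu|bu] := boolP (b \in msupp u).
  rewrite (big_fsetD1 b) //= eqxx mulr1 big1_fset ?addr0 // => b'.
  by rewrite !inE => /andP[/negPf-> _] _; rewrite mulr0.
rewrite (mcoeff_outdom bu) mul0r big_seq big1 // => b' b'u.
by case: eqVneq b'u bu => [->->|_ _ _] //; rewrite mulr0.
Qed.

Lemma weight_line p b (x : V) i :
  (forall b', bparity b' = i -> tN2_deg b' = p -> b' = b) ->
  tN2_homog i x -> weight p x -> x = x@_b *: << b >>.
Proof.
move=> b_only hx /weightP wx; apply/malgP => b'; rewrite mcoeffZ mcoeffU.
case: eqVneq => [->|neq]; first by rewrite mulr1.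
rewrite mulr0; have [/hx pb'|/mcoeff_outdom//] := boolP (b' \in msupp x).
have [dp|/wx//] := eqVneq (tN2_deg b') p.
by case/eqP: neq; rewrite (b_only b').
Qed.

Lemma half_int_neq (m n : int) : m%:~R != n%:~R + 2^-1 :> K.
Proof.
apply/eqP => E; have : (2 * m)%:~R = (2 * n + 1)%:~R :> K.
  by rewrite !(intrD, intrM) E; field.
by move/intr_inj; lia.
Qed.

Lemma Gdeg_inj : injective (Gdeg K).
Proof.
move=> k l; rewrite /Gdeg => /(mulIf _) E.
by apply/(@intr_inj K)/E; rewrite invr_eq0 pnatr_eq0.
Qed.

Lemma Tdeg_inj : injective (Tdeg K).
Proof. by move=> k l /addIr/intr_inj. Qed.

Lemma TdegE k : Tdeg K k = Gdeg K (2 * k + 1).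
Proof. by rewrite Gdeg_odd. Qed.

(** T has half-integral degrees while the other even basis vectors have
    integral ones, which leaves a line in each half-integral even degree. *)
Lemma weight_even_T k (x : V) :
  tN2_homog false x -> weight (Tdeg K k) x -> x = x@_(BT k) *: T k.
Proof.
apply: weight_line => -[m|l|l|] //= _.
- by move/eqP; rewrite (negPf (half_int_neq _ _)).
- by move/Tdeg_inj->.
- by move/eqP; rewrite -(mulr0z 1) (negPf (half_int_neq _ _)).
Qed.

Lemma weight_odd_G k (x : V) :
  tN2_homog true x -> weight (Gdeg K k) x -> x = x@_(BG k) *: G k.
Proof. by apply: weight_line => -[m|l|l|] //= _ /Gdeg_inj->. Qed.

Lemma weight_even0 (x : V) : tN2_homog false x -> weight 0 x ->
  x = x@_(BL 0) *: L 0 + x@_Bc *: c.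
Proof.
move=> hx /weightP wx; apply/malgP => b; rewrite mcoeffD !mcoeffZ !mcoeffU.
have [->|bL] := eqVneq b (BL 0); first by rewrite mulr1 mulr0 addr0.
have [->|bc] := eqVneq b Bc; first by rewrite mulr1 mulr0 add0r.
rewrite !mulr0 addr0.
have [/hx pb|/mcoeff_outdom//] := boolP (b \in msupp x).
apply: wx; case: b bL bc pb => [m|k|k|] //= bL _ _.
- by rewrite intr_eq0; apply: contraNneq bL => ->.
- by rewrite eq_sym -(mulr0z 1) half_int_neq.
Qed.

(** * Derivations of degree zero and generators *)

Lemma der_homogU i d b : hder i d -> tN2_homog (bparity b (+) i) (d << b >>).
Proof. by case=> _ dh _; apply: dh; apply: tN2_homogU. Qed.

Lemma der_brE i d a b : hder i d -> d (br << a >> << b >>) =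
  br (d << a >>) << b >> + (-1) ^+ (i && bparity a) *: br << a >> (d << b >>).
Proof. by case=> _ _; apply; apply: tN2_homogU. Qed.

Lemma der0 i d : hder i d -> d 0 = 0.
Proof.
by case=> dl _ _; have := dl (-1) 0 0; rewrite !scaleN1r oppr0 addr0 addNr.
Qed.

Lemma derZ i d a x : hder i d -> d (a *: x) = a *: d x.
Proof.
move=> hd; have [dl _ _] := hd.
by have := dl a x 0; rewrite !addr0 (der0 hd) addr0.
Qed.

Lemma derD i d x y : hder i d -> d (x + y) = d x + d y.
Proof. by case=> dl _ _; have := dl 1 x y; rewrite !scale1r. Qed.

Lemma der_br0 i d a b : hder i d ->
  d << a >> = 0 -> d << b >> = 0 -> d (br << a >> << b >>) = 0.
Proof.
move=> hd da db.
by rewrite (der_brE _ _ hd) da db tN2_br0l tN2_br0r scaler0 addr0.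
Qed.

Lemma der_kerZ i d a x : hder i d -> d (a *: x) = 0 -> a != 0 -> d x = 0.
Proof.
move=> hd dax a0; rewrite -[x]scale1r -(mulVf a0) -scalerA.
by rewrite (derZ _ _ hd) dax scaler0.
Qed.

Lemma hder_sub i d y : hder i d -> tN2_homog i y ->
  hder i (fun x => d x - br y x).
Proof. by move=> hd hy; apply: homog_derB hd _; apply: lsbr_homog_der. Qed.

Lemma brTG k l : br (T k) (G l) = G (l + (2 * k + 1)).
Proof. exact: tN2_brE. Qed.

Lemma brTT k l : br (T k) (T l) =
  ((k%:~R + 2^-1) / 3 * (k + l + 1 == 0)%:R) *: c.
Proof. exact: tN2_brE. Qed.

Lemma brG0G k : br (G 0) (G (2 * k)) = 2 *: L k
  + (3^-1 * (0 - 4^-1) * (k == 0)%:R) *: c.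
Proof.
have := bbrGG_ee (fun d => << d >> : V) 0 k.
by rewrite -tN2_brE !evE mulr0 add0r expr0n.
Qed.

Lemma brG0T k : br (G 0) (T k) = - G (2 * k + 1).
Proof. by rewrite tN2_brE /= add0r. Qed.

Lemma brG0Go k : br (G 0) (G (2 * k + 1)) = (k%:~R + 2^-1) *: T k.
Proof.
have := bbrGG_eo (fun d => << d >> : V) 0 k.
by rewrite -tN2_brE evE odE mulr0 !add0r opprK.
Qed.

Lemma brGT k l : br (G l) (T k) = - G (l + (2 * k + 1)).
Proof. exact: tN2_brE. Qed.

Lemma brTL k m : br (T k) (L m) = (k%:~R + 2^-1) *: T (k + m).
Proof. exact: tN2_brE. Qed.

(** The T_r and G_0 generate the algebra: [T_r, G_0] gives the G_p with p
    half-integral, a second bracket with some T_r gives the integral p, then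
    [T_(1/2), T_(-1/2)] is a nonzero multiple of c, and [G_0, G_p] gives L_p
    up to a multiple of c. *)
Lemma der_gen0 i d : hder i d ->
  (forall k, d (T k) = 0) -> d (G 0) = 0 -> forall x, d x = 0.
Proof.
move=> hd dT dG0; have d0 := der0 hd.
have dGo k : d (G (2 * k + 1)) = 0.
  by rewrite -[_ + 1]add0r -brTG (der_br0 hd).
have dGe k : d (G (2 * k)) = 0.
  rewrite (_ : 2 * k = (2 * 0 + 1) + (2 * (k - 1) + 1)); last by ring.
  by rewrite -brTG (der_br0 hd).
have dc : d c = 0.
  have := der_br0 hd (dT 0) (dT (-1)); rewrite brTT => /(der_kerZ hd); apply.
  by rewrite add0r mulr1 mulf_neq0 ?invr_eq0 ?pnatr_eq0.
have dL k : d (L k) = 0.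
  have := der_br0 hd dG0 (dGe k).
  rewrite brG0G (derD _ _ hd) (derZ (_ * _) _ hd).
  by rewrite dc scaler0 addr0 => /(der_kerZ hd); apply; rewrite pnatr_eq0.
apply: malg_ind => // [a x y dx dy|[m|k|k|]//].
  by rewrite (derD _ _ hd) (derZ _ _ hd) dx dy scaler0 addr0.
by have [a] := ev_od k; rewrite evE odE => -[]->.
Qed.

Lemma der_inner_of_gen i d y : hder i d -> tN2_homog i y ->
  (forall k, d (T k) = br y (T k)) -> d (G 0) = br y (G 0) ->
  d = br y.
Proof.
move=> hd hy dT dG0; apply/funext => x; apply/eqP; rewrite -subr_eq0.
apply/eqP; apply: (der_gen0 (hder_sub hd hy)) => [k|].
  by rewrite dT subrr.
by rewrite dG0 subrr.
Qed.

(** Apply d to [L_0, b] = - deg(b) b and compare the coefficients at b' of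
    degree different from deg(b): the term [d(L_0), b] has degree deg(b) and
    does not contribute, so (deg(b') - deg(b)) d(b)_b' = 0. *)
Lemma der_weight i d b : hder i d ->
  weight 0 (d (L 0)) -> weight (tN2_deg b) (d << b >>).
Proof.
move=> hd w0; apply/weightP => b' neq.
have hu : tN2_homog i (d (L 0)) := der_homogU (b := BL 0) hd.
have /weightP/(_ b') wu := weight_br hu (@tN2_homogU K b) w0 (weight_basis b).
have := der_brE (BL 0) b hd; rewrite andbF scale1r tN2_brL0 (derZ _ _ hd).
move/(congr1 (mcoeff b')); rewrite mcoeffD mcoeffZ mcoeff_brL0 wu ?add0r //.
move/eqP; rewrite -subr_eq0 -mulrBl mulf_eq0 opprK addrC subr_eq0.
by rewrite (negPf neq) => /eqP.
Qed.

Lemma der_weight0_sub i d : hder i d ->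
  exists2 y, tN2_homog i y & weight 0 (d (L 0) - br y (L 0)).
Proof.
move=> hd; have hu : tN2_homog i (d (L 0)) := der_homogU (b := BL 0) hd.
have [y hy yE] := exists_L0_integral hu; exists y => //.
rewrite (tN2_br_skew (@tN2_homogU K (BL 0)) hy) scale1r opprK.
apply/weightP => b b0; rewrite mcoeffD mcoeff_brL0 yE.
by rewrite mulNr mulrC divfK ?subrr.
Qed.

Lemma scale_basis_inj b (a a' : K) :
  a *: << b >> = a' *: << b >> :> V -> a = a'.
Proof. by move/(congr1 (mcoeff b)); rewrite !mcoeffZ mcoeffUU !mulr1. Qed.

Lemma arith_progressionE (t : int -> K) (r : K) :
  (forall k, t (k + 1) = t k + r) -> forall k, t k = t 0 + k%:~R * r.
Proof.
move=> tS; elim/int_rect => [|n IHn|n IHn]; first by rewrite mul0r addr0.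
  by rewrite -addn1 PoszD tS IHn intrD mulrDl mul1r addrA.
have nE : - n%:Z = - n.+1%:Z + 1 by lia.
by apply: (addIr r); rewrite -tS -nE IHn nE intrD mulrDl mul1r addrA.
Qed.

(** G_1, say, is reached from G_0 along several pairs of T_r; comparing the
    eigenvalues of d along them determines all t_r from the one at r = 1/2,
    and they coincide with those of a multiple of ad L_0. *)
Lemma even_der_inner d : hder false d -> weight 0 (d (L 0)) ->
  exists2 y, tN2_homog false y & d = br y.
Proof.
move=> hd w0.
have [t dT] : exists t : int -> K, forall k, d (T k) = t k *: T k.
  exists (fun k => (d (T k))@_(BT k)) => k.
  exact: weight_even_T (der_homogU (b := BT k) hd) (der_weight (BT k) hd w0).
have [s dG0] : exists s : K, d (G 0) = s *: G 0.
  exists ((d (G 0))@_(BG 0)).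
  exact: weight_odd_G (der_homogU (b := BG 0) hd) (der_weight (BG 0) hd w0).
have dGo k : d (G (2 * k + 1)) = (t k + s) *: G (2 * k + 1).
  rewrite -[_ + 1]add0r -brTG (der_brE _ _ hd) dT dG0 scale1r.
  by rewrite tN2_brZl tN2_brZr scalerDl.
(* [G_0, G_(1/2)] = 1/2 T_(1/2), and d scales the left side by 2 s + t 0 and
   the right side by t 0. *)
have s0 : s = 0.
  have := der_brE (BG 0) (BG (2 * 0 + 1)) hd.
  rewrite dG0 dGo scale1r tN2_brZl tN2_brZr -scalerDl brG0Go (derZ _ _ hd) dT.
  rewrite !scalerA => /scale_basis_inj E.
  have -> : s = (s + (t 0 + s)) * (0%:~R + 2^-1) - (0%:~R + 2^-1) * t 0.
    by field.
  by rewrite E subrr.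
rewrite {}s0 scale0r in dG0 dGo.
have dGe k l : d (G (2 * (k + l + 1))) = (t k + t l) *: G (2 * (k + l + 1)).
  rewrite (_ : 2 * _ = (2 * l + 1) + (2 * k + 1)); last by ring.
  rewrite -brTG (der_brE _ _ hd) dT dGo scale1r tN2_brZl tN2_brZr addr0.
  by rewrite scalerDl.
(* k = -1 and l = 0 stand for T_(-1/2) and T_(1/2), which bring G_0 back to
   itself, and d(G_0) = 0. *)
have tN1 : t (-1) = - t 0.
  apply/eqP; rewrite -addr_eq0; apply/eqP; apply: (scale_basis_inj (b := BG 0)).
  by rewrite scale0r -dG0 -[in LHS](mulr0 2) -[in LHS](dGe (-1) 0).
have tS k : t (k + 1) = t k + 2 * t 0.
  have : t (k + 1) + t (- 1) = t k + t 0.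
    apply: (scale_basis_inj (b := BG (2 * (k + 0 + 1)))); rewrite -dGe.
    by rewrite (_ : k + 0 = k + 1 + - 1) ?dGe //; ring.
  by rewrite tN1 => /(canRL (subrK _)) ->; ring.
(* The index k stands for r = k + 1/2, so t k = 2 r (t 0), to be compared
   with [L_0, T_r] = - r T_r. *)
have hy : tN2_homog false (- (2 * t 0) *: L 0).
  exact: tN2_homogZ (@tN2_homogU K (BL 0)).
exists (- (2 * t 0) *: L 0) => //; apply: der_inner_of_gen hd hy _ _ => [k|].
  rewrite dT (arith_progressionE tS) tN2_brZl tN2_brL0 scalerA.
  by congr (_ *: _); rewrite /= /Tdeg; field.
by rewrite dG0 tN2_brZl tN2_brL0 /= /Gdeg mul0r oppr0 scale0r scaler0.
Qed.

(** The T_r commute except for opposite indices, which forces d to act on all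
    of them as one multiple of ad G_0; the way back from G_0 to itself through
    T_(1/2) and T_(-1/2) then leaves no room for a difference on G_0. *)
Lemma odd_der_inner d : hder true d -> weight 0 (d (L 0)) ->
  exists2 y, tN2_homog true y & d = br y.
Proof.
move=> hd w0.
have [t dT] : exists t : int -> K, forall k, d (T k) = t k *: G (2 * k + 1).
  exists (fun k => (d (T k))@_(BG (2 * k + 1))) => k.
  apply: weight_odd_G (der_homogU (b := BT k) hd) _.
  by rewrite -TdegE; apply: (der_weight (BT k) hd).
have [a [b dG0]] : exists a b : K, d (G 0) = a *: L 0 + b *: c.
  have w := der_weight (BG 0) hd w0; rewrite /= /Gdeg mul0r in w.
  do 2!eexists; exact: weight_even0 (der_homogU (b := BG 0) hd) w.
have t_eq k l : k + l + 1 != 0 -> t k = t l.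
  move=> /negPf kl; have := der_brE (BT k) (BT l) hd.
  rewrite brTT kl mulr0 scale0r (der0 hd) !dT scale1r tN2_brZl tN2_brZr.
  rewrite brGT brTG scalerN addrC.
  rewrite (_ : 2 * l + 1 + _ = 2 * k + 1 + (2 * l + 1)); last by ring.
  by move/esym/eqP; rewrite subr_eq0 => /eqP/scale_basis_inj.
have t0 k : t k = t 0.
  (* T_(-1/2) and T_(1/2) do not commute; they are compared through T_(3/2). *)
  have [->|k1] := eqVneq k (-1); first by rewrite (t_eq (-1) 1) // (t_eq 1 0).
  by apply: t_eq; rewrite addr0 addr_eq0.
pose y : V := - t 0 *: G 0.
have hy : tN2_homog true y by exact: tN2_homogZ (@tN2_homogU K (BG 0)).
exists y => //; have hd' := hder_sub hd hy; set d' := (fun x => _) in hd'.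
have d'T k : d' (T k) = 0.
  by rewrite /d' dT t0 /y tN2_brZl brG0T scaleNr scalerN opprK subrr.
have [a' [b' d'G0]] : exists a' b' : K, d' (G 0) = a' *: L 0 + b' *: c.
  have := brG0G 0; rewrite mulr0 eqxx mulr1 => GG.
  rewrite /d' dG0 /y tN2_brZl GG scaleNr opprK scalerDr !scalerA addrACA.
  by rewrite -!scalerDl; do 2!eexists.
have d'Go k : d' (G (2 * k + 1)) = (a' * (k%:~R + 2^-1)) *: T k.
  rewrite -[_ + 1]add0r -brTG (der_brE _ _ hd') d'T d'G0 tN2_br0l add0r scale1r.
  by rewrite tN2_brDr !tN2_brZr brTL addr0 tN2_brE bbrcr scaler0 addr0 scalerA.
have d'G0c : d' (G 0) = (a' * 2^-1 * ((-1 + 2^-1) / 3)) *: c.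
  (* G_0 = [T_(-1/2), G_(1/2)]. *)
  rewrite [in LHS](_ : 0 = (2 * 0 + 1) + (2 * (-1) + 1)) //.
  rewrite -brTG (der_brE _ _ hd') d'T d'Go tN2_br0l add0r scale1r tN2_brZr.
  by rewrite brTT scalerA add0r mulr1 rmorphN1.
have a0 : a' = 0.
  have := congr1 (mcoeff (BL 0)) d'G0c.
  by rewrite d'G0 mcoeffD !mcoeffZ !mcoeffU eqxx mulr1 !mulr0 addr0.
apply: der_inner_of_gen hd hy _ _ => [k|];
  apply/eqP; rewrite -subr_eq0; apply/eqP.
  exact: d'T.
by have := d'G0c; rewrite a0 !mul0r scale0r.
Qed.

Lemma hder_inner i d : hder i d -> inner_der (twisted_N2 K) d.
Proof.
move=> hd; have [y hy w0] := der_weight0_sub hd.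
have [z _ dz] : exists2 z, tN2_homog i z & (fun x => d x - br y x) = br z.
  have := hder_sub hd hy; case: i {hd hy} => hd'.
    exact: odd_der_inner hd' w0.
  exact: even_der_inner hd' w0.
exists (y + z) => //; apply/funext => x.
have dzx : d x - br y x = br z x := congr1 (@^~ x) dz.
have dx : d x = br z x + br y x by rewrite -dzx subrK.
by rewrite lsbrDl addrC; apply: esym dx.
Qed.

End TwistedN2Derivations.

Theorem theorem1p1 (R : realType) :
  der (twisted_N2 R[i]) = inner_der (twisted_N2 R[i]).
Proof. by apply: der_eq_inner => i d; apply: hder_inner. Qed.
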